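(* Let $\mathbf{f}$ be the Fibonacci word and let $\mathbf{cubes_f}$ be the infinite binary word whose $n$-th term ($n\ge 0$) is $1$ if a cube ends at position $n$ of $\mathbf{f}$ and $0$ otherwise. Then $\mathbf{cubes_f}$ contains arbitrarily long runs of $1$'s. More precisely: if $i\ge 0$ is such that \[ (i)_F \in (10)^+\,0\,(0+10)\,(00)^*\,0\,w, \qquad \text{where } w \in 0(10)^*(\epsilon+1), \] then $\mathbf{cubes_f}$ contains a run of $1$'s beginning at position $i$ of length \begin{itemize} \item $F_{2n+2}-1$, if $|w|=2n$ for some $n\ge 0$; \item $F_{2n+3}-1$, if $|w|=2n+1$ for some $n\ge 0$. \end{itemize}
   Context: The Fibonacci word is $\mathbf{f}=010010100100101001010010\cdots$, the fixed point of the morphism $0\mapsto 01$, $1\mapsto 0$; its letters are indexed starting from position $0$, and $\mathbf{f}[a..b]$ denotes the factor occupying positions $a$ through $b$. A cube is a word of the form $xxx$ with $x$ nonempty. A cube ends at position $j$ of $\mathbf{f}$ if there exist $i\ge 0$ and $m\ge 1$ with $j=i+3m-1$ such that $\mathbf{f}[i..j]=xxx$ for some word $x$ of length $m$. Fibonacci numbers: $F_0=0$, $F_1=1$, $F_{k+2}=F_{k+1}+F_k$. For $n\ge 0$, $(n)_F$ is the canonical Fibonacci (Zeckendorf) representation of $n$: the unique binary word $d_{k}\cdots d_2$ (most significant digit first), with no leading $0$ and no two consecutive $1$'s, such that $n=\sum_j d_jF_j$ (so the last digit has weight $F_2=1$, the next $F_3=2$, etc.); $(0)_F$ is the empty word.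 In the regular expressions, $+$ between words denotes union, $^*$ Kleene star, $^+$ one or more repetitions, $\epsilon$ the empty word, and $|w|$ the length of $w$. A run of $1$'s of length $\ell\ge1$ beginning at position $i$ in a binary word $\mathbf{u}=u_0u_1\cdots$ means $u_i=\cdots=u_{i+\ell-1}=1$, $u_{i+\ell}=0$, and either $i=0$ or $u_{i-1}=0$ (i.e., a maximal block of $1$'s). *)

(* Defs.v *)
(* Binary words are [seq bool], infinite binary words are
   [nat -> bool], with false = 0 and true = 1. *)
From mathcomp Require Import all_boot.
From mathcomp Require Import boolp.

Set Implicit Arguments.
Unset Strict Implicit.
Unset Printing Implicit Defensive.

Definition fib_letter (a : bool) : seq bool :=
  if a then [:: false] else [:: false; true].

Definition fib_morph (s : seq bool) : seq bool := flatten (map fib_letter s).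

Definition fib_prefix (k : nat) : seq bool := iter k fib_morph [:: false].

(* [fib_prefix n] has more than [n] letters and is a prefix of every later
   iterate, so the default value of [nth] is never used; [fib_word_fixed]
   below says that this is the fixed point of the morphism. *)
Definition fib_word (n : nat) : bool := nth false (fib_prefix n) n.

Definition factor (u : nat -> bool) (a b : nat) : seq bool :=
  [seq u k | k <- iota a (b.+1 - a)].

Definition cube_ends_at (u : nat -> bool) (j : nat) : Prop :=
  exists (i m : nat) (x : seq bool),
    [/\ 0 < m, j = i + 3 * m - 1, size x = m & factor u i j = x ++ x ++ x].

Definition cubes_f (n : nat) : bool := `[< cube_ends_at fib_word n >].

Definition run_of_ones (u : nat -> bool) (i l : nat) : Prop :=
  [/\ 0 < l,
      forall k, i <= k < i + l -> u k = true,
      u (i + l) = false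
    & i = 0 \/ u (i - 1) = false].

Fixpoint fib (n : nat) : nat :=
  match n with
  | 0 => 0
  | 1 => 1
  | (k.+1 as p).+1 => fib p + fib k
  end.

(* Most significant digit first: the last digit has weight F_2. *)
Definition fib_value (d : seq bool) : nat :=
  \sum_(k < size d) nth false (rev d) k * fib (k + 2).

(* [is_fib_rep n d] says that [d] is the word (n)_F; the default [true] of [head]
   lets the empty word through, and [sorted] compares adjacent digits only. *)
Definition is_fib_rep (n : nat) (d : seq bool) : Prop :=
  [/\ head true d = true,
      sorted (fun a b : bool => ~~ (a && b)) d
    & fib_value d = n].

Definition language := seq bool -> Prop.

Definition lword (u : seq bool) : language := fun w => w = u.

Definition lunion (A B : language) : language := fun w => A w \/ B w.

Definition lcat (A B : language) : language :=
  fun w => exists u v, [/\ A u, B v & w = u ++ v].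

Inductive lstar (A : language) : language :=
  | lstar_nil : lstar A [::]
  | lstar_cat u v : A u -> lstar A v -> lstar A (u ++ v).

Definition lplus (A : language) : language := lcat A (lstar A).

Definition w0 : language := lword [:: false].
Definition w1 : language := lword [:: true].
Definition w00 : language := lword [:: false; false].
Definition w10 : language := lword [:: true; false].
Definition weps : language := lword [::].

(* (10)^+ 0 (0+10) (00)^* 0 *)
Definition run_start_prefix : language :=
  lcat (lplus w10) (lcat w0 (lcat (lunion w0 w10) (lcat (lstar w00) w0))).

(* 0 (10)^* (eps+1) *)
Definition run_start_suffix : language :=
  lcat w0 (lcat (lstar w10) (lunion weps w1)).

Lemma fib_morph_cat s t : fib_morph (s ++ t) = fib_morph s ++ fib_morph t.
Proof. by rewrite /fib_morph map_cat flatten_cat. Qed.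

Lemma fib_prefixS k : exists t, fib_prefix k.+1 = fib_prefix k ++ t.
Proof.
elim: k => [|k [t IH]]; first by exists [:: true].
exists (fib_morph t).
have E j : fib_prefix j.+1 = fib_morph (fib_prefix j) by [].
by rewrite (E k.+1) {1}IH fib_morph_cat -E.
Qed.

Lemma fib_prefix_le k m : k <= m -> exists t, fib_prefix m = fib_prefix k ++ t.
Proof.
move=> /subnK <-; elim: (m - k) => [|d [t IH]].
  by exists [::]; rewrite cats0.
have [t' ->] := fib_prefixS (d + k); rewrite IH -catA; by exists (t ++ t').
Qed.

Lemma size_fib_morph s : size s <= size (fib_morph s).
Proof.
elim: s => //= a s IH.
by rewrite /fib_morph /= size_cat; case: a => /=; rewrite ?ltnS // ltnW.
Qed.

Lemma size_fib_prefix n : n < size (fib_prefix n).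
Proof.
have H k : exists s, fib_prefix k = false :: s /\ k <= size s.
  elim: k => [|k [s [E Hs]]]; first by exists [::].
  exists (true :: fib_morph s); split; last first.
    by rewrite /= ltnS (leq_trans Hs) // size_fib_morph.
  by rewrite /fib_prefix iterS -/(fib_prefix k) E.
by have [s [-> Hs]] := H n; rewrite /= ltnS.
Qed.

Lemma fib_wordE m n : n < size (fib_prefix m) ->
  fib_word n = nth false (fib_prefix m) n.
Proof.
move=> Hm; rewrite /fib_word; case: (leqP m n) => [|/ltnW] /fib_prefix_le [t E].
  by rewrite E nth_cat Hm.
by rewrite E nth_cat size_fib_prefix.
Qed.

Lemma fib_word_fixed n :
  mkseq fib_word (size (fib_morph (mkseq fib_word n))) =
  fib_morph (mkseq fib_word n).
Proof.
have E : take n (fib_prefix n) = mkseq fib_word n.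
  have Hn : n <= size (fib_prefix n) by exact/ltnW/size_fib_prefix.
  apply: (@eq_from_nth _ false) => [|i].
    by rewrite size_mkseq size_takel.
  rewrite size_takel // => Hi; rewrite nth_take // nth_mkseq //.
  by rewrite (@fib_wordE n) // (leq_trans Hi).
have [t Et] : exists t, fib_prefix n.+1 = fib_morph (mkseq fib_word n) ++ t.
  exists (fib_morph (drop n (fib_prefix n))).
  by rewrite -E -fib_morph_cat cat_take_drop.
apply: (@eq_from_nth _ false) => [|i]; rewrite size_mkseq // => Hi.
rewrite nth_mkseq // (@fib_wordE n.+1) Et ?nth_cat ?Hi //.
by rewrite size_cat (leq_trans Hi) // leq_addr.
Qed.

(* Main.v *)
(* Let psi = (1 - sqrt 5) / 2. The Fibonacci word codes the rotation of R/Z by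
   psi, and F_k psi = psi^k mod 1. A cube of order m starts at a iff the number
   of 1's in the window of length m stays constant while the window slides from
   a to a + 2m, i.e. iff the orbit avoids, or stays in, an interval of length
   ||m psi|| for 2m + 1 consecutive steps. If F_k < m < F_{k+1}, this interval
   and its complement have length at least |psi|^(k-1), and every such interval
   is hit within F_{k+1} steps: all cubes have order F_K. A cube of order F_K
   can end at j only if no M in [j+2-2F_K, j+2] has M psi in psi^K (0,1) mod 1.

   Put k = |w| + 3. The regular expression amounts to
   i + 1 = F_Q - F_R + F_{k-2} with R = k + 2b + 2 and Q >= R + 2, so that
   (i + 1) psi = psi^Q - psi^R + psi^(k-2) mod 1. The point i + 1 - 2F_k then
   lies in psi^k (0,1), and the next return is F_{k+2} steps later, which makes
   all of the F_{k-1} - 1 positions from i on ends of cubes of order F_k. The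
   positions j just before and just after satisfy j + 2 = F_Q - F_R + F_c with
   c = k - 2 and c = k respectively; there, every order F_K has an explicit
   obstruction M, a signed sum of at most four Fibonacci numbers. *)
From Stdlib Require Import Reals Lra.
Require Import Defs.
From mathcomp Require Import all_boot.
From mathcomp Require Import zify.
From mathcomp Require boolp.

Set Implicit Arguments.
Unset Strict Implicit.
Unset Printing Implicit Defensive.

(** * Fibonacci numbers, prefixes of the Fibonacci word, and cubes *)

Lemma fibSS n : fib n.+2 = fib n.+1 + fib n.
Proof. by []. Qed.

Lemma fib_gt0 n : 0 < fib n.+1.
Proof. by elim: n => // n IH; rewrite fibSS; lia. Qed.

Lemma leq_fib m n : m <= n -> fib m <= fib n.
Proof.
apply: (homo_leq (@leqnn) leq_trans) => -[|k] //.
by rewrite fibSS leq_addr.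
Qed.

Lemma between_fib m : 0 < m ->
  exists2 k, 2 <= k & fib k <= m < fib k.+1.
Proof.
elim: m => // -[_ _|m /(_ isT) [k k2 /andP[H1 H2]]]; first by exists 2.
case: (ltnP m.+2 (fib k.+1)) => H; first by exists k => //; rewrite (leq_trans H1).
exists k.+1; first by rewrite ltnS ltnW.
move: k2 H; case: (k) H1 H2 => [|[|j]] // H1 H2 _ H; rewrite fibSS; have := fib_gt0 j.
by move: H1 H2 H; rewrite !fibSS; lia.
Qed.

Lemma fib_prefixSS k : fib_prefix k.+2 = fib_prefix k.+1 ++ fib_prefix k.
Proof.
elim: k => // k IH.
have E j : fib_prefix j.+1 = fib_morph (fib_prefix j) by [].
by rewrite [LHS]E [in LHS]IH fib_morph_cat -!E.
Qed.

Lemma size_fib_prefixE k : size (fib_prefix k) = fib k.+2.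
Proof.
elim/ltn_ind: k => -[|[|k]] IH //.
by rewrite fib_prefixSS size_cat !IH.
Qed.

Lemma count_fib_prefix k : count id (fib_prefix k) = fib k.
Proof.
elim/ltn_ind: k => -[|[|k]] IH //.
by rewrite fib_prefixSS count_cat !IH.
Qed.

Definition ones (n : nat) : nat := \sum_(k < n) fib_word k.

Lemma onesS n : ones n.+1 = ones n + fib_word n.
Proof. by rewrite /ones big_ord_recr. Qed.

Lemma ones_take k n : n <= fib k.+2 -> ones n = count id (take n (fib_prefix k)).
Proof.
elim: n => [|n IH] Hn; first by rewrite /ones big_ord0 take0.
rewrite onesS IH; last exact: ltnW.
rewrite (take_nth false) ?size_fib_prefixE // -cats1 count_cat /= addn0.
by rewrite (@fib_wordE k) // size_fib_prefixE.
Qed.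

(** After the block [fib_prefix k.+1], of length F_(k+3) with F_(k+1) 1's, the word starts afresh
    with [fib_prefix k]. *)
Lemma ones_fib_add k n : n <= fib k.+2 ->
  ones (fib k.+3 + n) = fib k.+1 + ones n.
Proof.
move=> Hn; rewrite (@ones_take k.+2); last by rewrite (fibSS k.+2) leq_add2l.
rewrite fib_prefixSS take_cat size_fib_prefixE.
have -> : (fib k.+3 + n < fib k.+3) = false by lia.
rewrite addKn.
by rewrite count_cat count_fib_prefix -ones_take.
Qed.

(** A window of length 3m is a cube iff it has period m; [j.+1] avoids truncated subtraction. *)
Lemma cube_ends_atP u j : cube_ends_at u j <->
  exists a m, [/\ 0 < m, j.+1 = a + 3 * m &
                  forall n, a <= n < a + 2 * m -> u (n + m) = u n].
Proof.
split=> [[a [m [x [m0 -> sx E]]]]|[a [m [m0 Ej H]]]].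
  exists a, m; split=> //; first by lia.
  have N n : n < 3 * m -> u (a + n) = nth false (x ++ x ++ x) n.
    move=> Hn; rewrite -E /factor (nth_map 0) ?size_iota; last by lia.
    by rewrite nth_iota //; lia.
  move=> n Hn; have [d Ed] : exists d, n = a + d by exists (n - a); lia.
  rewrite Ed -addnA !N; try lia.
  rewrite !nth_cat sx.
  have -> : d + m < m = false by lia.
  rewrite addnK; case: ltnP => Hd //.
  by have -> : d - m < m by lia.
exists a, m, [seq u k | k <- iota a m]; split=> //; first by lia.
  by rewrite size_map size_iota.
rewrite /factor (_ : j.+1 - a = m + (m + m)); last by lia.
rewrite !iotaD !map_cat; congr (_ ++ _).
have E b : a <= b -> b + m <= a + 2 * m ->
    [seq u k | k <- iota (b + m) m] = [seq u k | k <- iota b m].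
  move=> H1 H2; rewrite [b + m]addnC iotaDl -map_comp.
  by apply/eq_in_map => k; rewrite mem_iota => Hk /=; rewrite addnC H //; lia.
by rewrite !E //; lia.
Qed.

Open Scope R_scope.

(** * Powers of psi and congruences modulo 1 *)

Definition psi : R := (1 - sqrt 5) / 2.

Lemma psi2 : psi * psi = psi + 1.
Proof. by rewrite /psi; have := sqrt_def 5 ltac:(lra); nra. Qed.

Lemma psi_powSS n : psi ^ n.+2 = psi ^ n.+1 + psi ^ n.
Proof.
have -> : psi ^ n.+2 = psi * psi * psi ^ n by rewrite /=; ring.
by rewrite psi2 /=; ring.
Qed.

Lemma psi_bounds : -0.61804 < psi < -0.61803.
Proof.
have s0 := sqrt_pos 5; have s2 := sqrt_def 5 ltac:(lra).
by rewrite /psi; split; nra.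
Qed.

Lemma psi_odd n : odd n -> psi <= psi ^ n < 0.
Proof.
have := psi_bounds; have := psi2.
move=> p2 pb on; have -> : n = n./2.*2.+1 by rewrite -{1}(odd_double_half n) on.
elim: (n./2) => [|m IH]; first by rewrite /=; lra.
by rewrite doubleS; move: IH => /=; set z := psi ^ _; nra.
Qed.

Lemma psi_even n : ~~ odd n -> 0 < psi ^ n <= 1.
Proof.
have := psi_bounds; have := psi2.
move=> p2 pb on; have -> : n = n./2.*2 by rewrite -{1}(odd_double_half n) (negbTE on).
elim: (n./2) => [|m IH]; first by rewrite /=; lra.
by rewrite doubleS; move: IH => /=; set z := psi ^ _; nra.
Qed.

(** The extremes are psi^3 and psi^2, rounded outwards. *)
Lemma psi_ge2 n : (2 <= n)%N -> -0.2361 <= psi ^ n <= 0.3821.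
Proof.
have := psi_bounds; have := psi2; case: n => [|[|n]] // p2 pb _.
have E : psi ^ n.+2 = (psi + 1) * psi ^ n by rewrite -psi2 /=; ring.
rewrite E; case: (boolP (odd n)) => [/psi_odd|/psi_even];
  by set z := psi ^ n => -[z1 z2]; split; nra.
Qed.

(** Both sides obey the Fibonacci recurrence, because psi^2 = psi + 1. *)
Lemma psi_fib n : INR (fib n.+1) * psi = psi ^ n.+1 - INR (fib n).
Proof.
elim/ltn_ind: n => -[|[|n]] IH; [rewrite /=; lra|have := psi2; rewrite /=; lra|].
have H1 := IH n.+1 ltac:(lia); have H2 := IH n ltac:(lia).
rewrite (psi_powSS n.+1) (fibSS n.+1) plus_INR Rmult_plus_distr_r H1 H2.
by rewrite (fibSS n) plus_INR; ring.
Qed.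

Lemma psi_delta k : psi ^ k = (- psi) ^ k \/ psi ^ k = - (- psi) ^ k.
Proof. by elim: k => [|k [E|E]] /=; [left|rewrite E; right|rewrite E; left]; lra. Qed.

Lemma delta_gt0 k : 0 < (- psi) ^ k.
Proof. by apply: pow_lt; have := psi_bounds; lra. Qed.

Lemma deltaSS k : (- psi) ^ k.+2 = (- psi) ^ k - (- psi) ^ k.+1.
Proof.
have -> : (- psi) ^ k.+2 = psi * psi * (- psi) ^ k by rewrite /=; ring.
by rewrite psi2 /=; ring.
Qed.

(* [cong N e]: going N steps along the rotation by psi amounts to a
   displacement by e on the circle R/Z. *)
Definition cong (N : Z) (e : R) : Prop := exists p : Z, IZR N * psi = IZR p + e.

Lemma cong_add M N d e : cong M d -> cong N e -> cong (M + N) (d + e).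
Proof. by move=> [p E] [q F]; exists (p + q)%Z; rewrite !plus_IZR; lra. Qed.

Lemma cong_sub M N d e : cong M d -> cong N e -> cong (M - N) (d - e).
Proof. by move=> [p E] [q F]; exists (p - q)%Z; rewrite !minus_IZR; lra. Qed.

Lemma cong_addZ N z e : cong N e -> cong N (e + IZR z).
Proof. by move=> [p E]; exists (p - z)%Z; rewrite minus_IZR; lra. Qed.

Lemma cong_uniq N d e : cong N d -> cong N e -> exists z, d = e + IZR z.
Proof. by move=> [p E] [q F]; exists (q - p)%Z; rewrite minus_IZR; lra. Qed.

Lemma cong_fib k : cong (Z.of_nat (fib k)) (psi ^ k).
Proof.
case: k => [|k]; first by exists (-1)%Z; rewrite /=; lra.
by exists (- Z.of_nat (fib k))%Z; rewrite opp_IZR -!INR_IZR_INZ psi_fib; ring.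
Qed.

(** * The orbit of the rotation: small displacements and hitting times *)

Lemma IZR_small z : -1 < IZR z < 1 -> IZR z = 0.
Proof. by move=> [/lt_IZR H1 /lt_IZR H2]; congr IZR; lia. Qed.

(* The point (n + 1) psi of R/Z, represented in (0, 1). *)
Definition rot (n : nat) : R := INR n.+1 * (psi + 1) - INR (ones n).

Lemma cong_rot n : cong (Z.of_nat n.+1) (rot n).
Proof.
exists (Z.of_nat (ones n) - Z.of_nat n.+1)%Z.
by rewrite minus_IZR -!INR_IZR_INZ /rot; ring.
Qed.

(** An equality of reals, not only modulo 1: the exact count in [ones_fib_add] excludes a
    wrap-around. *)
Lemma rot_fib_add k n : (n <= fib k.+2)%N ->
  rot (fib k.+3 + n) = rot n + psi ^ k.+3.
Proof.
move=> Hn; rewrite /rot ones_fib_add // -addnS.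
rewrite (plus_INR (fib k.+3)) (plus_INR (fib k.+1)).
have F : INR (fib k.+3) = INR (fib k.+2) + INR (fib k.+1).
  by rewrite -plus_INR.
by have := psi_fib k.+2; lra.
Qed.

(** An index r + F_(k-1) with r < F_(k-2) displaces [rot r] by psi^(k-1), and |psi|^(k-2) -
    |psi|^(k-1) = |psi|^k. *)
Lemma rot_bound_le k n : (2 <= k)%N -> (n < fib k)%N ->
  (- psi) ^ k <= rot n <= 1 - (- psi) ^ k.
Proof.
elim/ltn_ind: k n => -[|[|[|[|k]]]] IH n // _.
- case: n => // _; have := psi_bounds; have := psi2.
  by rewrite /rot /ones big_ord0 /=; nra.
- have := psi_bounds; have := psi2; have D := deltaSS 1.
  by case: n => [|[|n]] // p2 pb _; rewrite /rot /ones ?big_ord_recr big_ord0 /=; nra.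
move=> Hn; have G := delta_gt0; have D := deltaSS k.+2.
case: (ltnP n (fib k.+3)) => H.
  by have := IH k.+3 ltac:(lia) n isT H; have := deltaSS k.+3; have := G k.+4.+1; lra.
have [r Er] : exists r, n = (fib k.+3 + r)%N by exists (n - fib k.+3)%N; lia.
have Hr : (r < fib k.+2)%N by move: Hn; rewrite Er (fibSS k.+2); lia.
have := IH k.+2 ltac:(lia) r isT Hr; rewrite Er rot_fib_add; last exact: ltnW.
by have := G k.+3; case: (psi_delta k.+3) => ->; lra.
Qed.

(** Best approximation: the bound of [rot_bound_le] persists up to the next Fibonacci number, again
    by splitting off the largest one. *)
Lemma rot_bound k n : (n.+1 < fib k.+1)%N ->
  (- psi) ^ k <= rot n <= 1 - (- psi) ^ k.
Proof.
elim/ltn_ind: k n => -[|[|k]] IH n // Hn; have G := delta_gt0.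
have D := deltaSS k; have D1 := deltaSS k.+1.
case: (ltngtP n.+1 (fib k.+2)) => H; last by apply: rot_bound_le; lia.
  by have := IH k.+1 ltac:(lia) n H; have := G k.+3; lra.
case: k IH Hn D D1 H => [|k] IH Hn D D1 H; first by move: H Hn; rewrite /=; lia.
have [r Er] : exists r, n = (fib k.+3 + r)%N by exists (n - fib k.+3)%N; lia.
have Hr : (r.+1 < fib k.+2)%N by move: Hn; rewrite Er (fibSS k.+2); lia.
have := IH k.+1 ltac:(lia) r Hr; rewrite Er rot_fib_add; last by lia.
by have := G k.+3; have := G k.+4; case: (psi_delta k.+3) => ->; lra.
Qed.

(** This is the rotation coding: the number of 1's is the integer part of (n + 1)(psi + 1). *)
Lemma rot01 n : 0 < rot n < 1.
Proof.
have [k _ /andP[_ H]] := between_fib (ltn0Sn n).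
by have := rot_bound H; have := delta_gt0 k; lra.
Qed.

Lemma rot_eq n e : cong (Z.of_nat n.+1) e -> 0 <= e < 1 -> rot n = e.
Proof.
move=> /(cong_uniq (cong_rot n)) [z E] He; have R := rot01 n.
by rewrite E IZR_small; lra.
Qed.

(** Induction on K: the interval from c + psi^(K+1) to c + psi^(K+2) contains the target, and a
    point of it beyond c is brought back by F_(K+1) further steps. *)
Lemma cong_cover K N c : exists s y,
  [/\ (s < fib K.+2)%N, 0 <= y <= 1 & cong (N + Z.of_nat s) (c + psi ^ K * y)].
Proof.
elim: K c => [|K IH] c.
  exists 0%N, (IZR N * psi - c - IZR (Int_part (IZR N * psi - c))); split=> //.
    by have := base_Int_part (IZR N * psi - c); lra.
  by exists (Int_part (IZR N * psi - c)); rewrite Z.add_0_r /=; lra.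
have pb := psi_bounds; have p2 := psi2.
have [s [y [Hs Hy C]]] := IH (c + psi ^ K.+1).
have F := fibSS K.+1.
case: (Rle_dec y (- psi)) => H.
  (* Since 1 / psi = psi - 1, this rescales the unit from psi^K to psi^(K+1). *)
  exists s, (1 + (psi - 1) * y); split; [lia|nra|].
  move: C; congr (cong _ _).
  have -> : psi ^ K.+1 * (1 + (psi - 1) * y) =
            psi ^ K.+1 + (psi * psi - psi) * psi ^ K * y by rewrite /=; ring.
  by rewrite p2; ring.
exists (s + fib K.+1)%N, (2 + (psi - 1) * y); split; [lia|nra|].
have := cong_add C (cong_fib K.+1); congr (cong _ _); first by lia.
have -> : psi ^ K.+1 * (2 + (psi - 1) * y) =
          2 * psi ^ K.+1 + (psi * psi - psi) * psi ^ K * y by rewrite /=; ring.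
by rewrite p2; ring.
Qed.

Lemma rot_cover K a c : exists n e,
  [/\ (a <= n < a + fib K.+2)%N, c <= e <= c + (- psi) ^ K & cong (Z.of_nat n.+1) e].
Proof.
have G := delta_gt0 K.
case: (psi_delta K) => E.
  have [s [y [Hs Hy C]]] := cong_cover K (Z.of_nat a.+1) c.
  exists (a + s)%N, (c + psi ^ K * y); split; [lia|rewrite E; nra|].
  by move: C; congr (cong _ _); lia.
have [s [y [Hs Hy C]]] := cong_cover K (Z.of_nat a.+1) (c + (- psi) ^ K).
exists (a + s)%N, (c + (- psi) ^ K + psi ^ K * y); split; [lia|rewrite E; nra|].
by move: C; congr (cong _ _); lia.
Qed.

(** * Cubes in terms of the rotation, and their possible orders *)

Definition has_cube_at (a m : nat) : Prop :=
  forall n, (a <= n < a + 2 * m)%N -> fib_word (n + m) = fib_word n.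

Lemma rot_diff n m :
  rot (n + m) - rot n = INR m * (psi + 1) - (INR (ones (n + m)) - INR (ones n)).
Proof. by rewrite /rot !S_INR plus_INR; ring. Qed.

(** From n to n + 1 the displacement over m steps changes by the difference of the letters at n and
    n + m. *)
Lemma has_cube_rot a m : has_cube_at a m <->
  forall n, (a <= n <= a + 2 * m)%N -> rot (n + m) - rot n = rot (a + m) - rot a.
Proof.
have N n : rot (n.+1 + m) - rot n.+1 =
   rot (n + m) - rot n - (INR (fib_word (n + m)) - INR (fib_word n)).
  by rewrite !rot_diff addSn !onesS !plus_INR; ring.
split=> H n Hn.
  have [d Ed] : exists d, n = (a + d)%N by exists (n - a)%N; lia.
  rewrite {}Ed in Hn *.
  elim: d Hn => [|d IH] Hn; first by rewrite addn0.
  by rewrite addnS N IH ?H; [ring|lia|lia].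
have := H n.+1 ltac:(lia); rewrite N H; last by lia.
by case: (fib_word _); case: (fib_word _) => //=; lra.
Qed.

(** The displacement over m steps is mu - 1 or mu, according to whether the point reaches 1 - mu.
    Both arcs have length at least |psi|^(k-1), so both values occur in the window, at n1 and n2. *)
Lemma no_cube_nonfib a m k : (fib k < m < fib k.+1)%N -> ~ has_cube_at a m.
Proof.
case: k => [|[|[|k]]] Hm; try by move: Hm; rewrite /=; lia.
move=> /has_cube_rot H.
have [r Er] : exists r, m = (fib k.+3 + r).+1 by exists (m - fib k.+3 - 1)%N; lia.
have Hr : (r.+1 < fib k.+2)%N by move: Hm; rewrite Er (fibSS k.+2); lia.
have := rot_bound Hr; have := @rot_fib_add k r ltac:(lia).
set mu := rot (_ + _) => Emu Br.
have G := delta_gt0; have D := deltaSS k.+1.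
have Bmu : (- psi) ^ k.+2 <= mu <= 1 - (- psi) ^ k.+2.
  rewrite Emu; have := G k.+3; have := deltaSS k.+2.
  by case: (psi_delta k.+3) => ->; lra.
have Cmu : cong (Z.of_nat m) mu by rewrite Er; apply: cong_rot.
have Cadd n e : cong (Z.of_nat n.+1) e -> cong (Z.of_nat (n + m).+1) (e + mu).
  by move=> C; have := cong_add C Cmu; congr (cong _ _); lia.
have [n1 [e1 [Hn1 He1 C1]]] := rot_cover k.+2 a (1 - mu).
have [n2 [e2 [Hn2 He2 C2]]] := rot_cover k.+2 a 0.
have R1 := rot01 n1; have R2 := rot01 (n2 + m).
(* The covering arcs are closed; their right ends are excluded because [rot] never vanishes. *)
have e1lt : e1 < 1.
  case: (Rlt_dec e1 1) => // He.
  by have := rot_eq (cong_addZ (-1) C1); lra.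
have e2lt : e2 + mu < 1.
  case: (Rlt_dec (e2 + mu) 1) => // He.
  by have := rot_eq (cong_addZ (-1) (Cadd _ _ C2)); lra.
have T1 := rot_eq C1 ltac:(have := G k.+2; lra).
have T2 := rot_eq C2 ltac:(have := G k.+2; lra).
have T1m := rot_eq (cong_addZ (-1) (Cadd _ _ C1)) ltac:(lra).
have T2m := rot_eq (Cadd _ _ C2) ltac:(have := G k.+2; lra).
have F := fibSS k.+2; have F1 := fibSS k.+1.
have := H n1 ltac:(lia); have := H n2 ltac:(lia); lra.
Qed.

(** A jump of F_K steps arriving at psi^K y crosses 0, whereas the jump just after or just before it
    does not. One of these neighbours also lies in the window, so the displacement is not
    constant. *)
Lemma no_cube_fib a K M y : (2 <= K)%N -> 0 < y < 1 ->
  cong M (psi ^ K * y) ->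
  (Z.of_nat (a + fib K).+1 <= M <= Z.of_nat (a + 3 * fib K).+1)%Z ->
  ~ has_cube_at a (fib K).
Proof.
move=> K2 Hy C HM /has_cube_rot H.
have [n En] : exists n, M = Z.of_nat (n + fib K).+1.
  by exists (Z.to_nat M - fib K - 1)%N; lia.
have P := psi_ge2 K2; have Pz : psi ^ K <> 0.
  by case: (psi_delta K) => ->; have := delta_gt0 K; lra.
have C1 : cong (Z.of_nat (n + fib K).+1) (psi ^ K * y) by rewrite -En.
have C0 : cong (Z.of_nat n.+1) (psi ^ K * (y - 1)).
  by have := cong_sub C1 (cong_fib K); congr (cong _ _); [lia|ring].
have C2 : cong (Z.of_nat (n + fib K + fib K).+1) (psi ^ K * (y + 1)).
  by have := cong_add C1 (cong_fib K); congr (cong _ _); [lia|ring].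
case: (Rlt_dec 0 (psi ^ K)) => Ps.
  have T1 := rot_eq C1 ltac:(nra).
  have T0 := rot_eq (cong_addZ 1 C0) ltac:(nra).
  case: (leqP (n + fib K) (a + 2 * fib K)) => Hn.
    have := H n ltac:(lia); have := H (n + fib K)%N ltac:(lia).
    by rewrite T0 T1 (rot_eq C2); nra.
  have [b Eb] : exists b, n = (b + fib K)%N by exists (n - fib K)%N; lia.
  have := H n ltac:(lia); have := H b ltac:(lia).
  rewrite -Eb T0 T1.
  have Cb : cong (Z.of_nat b.+1) (psi ^ K * (y - 2)).
    by have := cong_sub C0 (cong_fib K); congr (cong _ _); [lia|ring].
  by rewrite (rot_eq (cong_addZ 1 Cb)); nra.
have T1 := rot_eq (cong_addZ 1 C1) ltac:(nra).
have T0 := rot_eq C0 ltac:(nra).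
case: (leqP (n + fib K) (a + 2 * fib K)) => Hn.
  have := H n ltac:(lia); have := H (n + fib K)%N ltac:(lia).
  by rewrite T0 T1 (rot_eq (cong_addZ 1 C2)); nra.
have [b Eb] : exists b, n = (b + fib K)%N by exists (n - fib K)%N; lia.
have := H n ltac:(lia); have := H b ltac:(lia).
rewrite -Eb T0 T1.
have Cb : cong (Z.of_nat b.+1) (psi ^ K * (y - 2)).
  by have := cong_sub C0 (cong_fib K); congr (cong _ _); [lia|ring].
by rewrite (rot_eq Cb); nra.
Qed.

(** * Positions at which no cube ends *)

Lemma cubes_f_false j :
  (forall K, (2 <= K)%N -> (3 * fib K <= j.+1)%N -> exists M y,
     [/\ 0 < y < 1, cong M (psi ^ K * y) &
         (Z.of_nat j.+2 - 2 * Z.of_nat (fib K) <= M <= Z.of_nat j.+2)%Z]) ->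
  cubes_f j = false.
Proof.
move=> W; apply: boolp.asboolF => /cube_ends_atP [a [m [m0 Ej H]]].
have [K K2 /andP[]] := between_fib m0; rewrite leq_eqVlt => /orP[/eqP Em _|H1 H2].
  have [M [y [Hy C HM]]] := W K K2 ltac:(lia).
  apply: (no_cube_fib K2 Hy C (a := a)); first by lia.
  by rewrite Em.
by apply: (@no_cube_nonfib a m K) => //; rewrite H1.
Qed.

(** This is (psi^(R+q) - psi^R) / psi^c for R = c + 2b + 2, the relative perturbation of psi^c;
    0.4724 bounds 0.3821 * 1.2361. *)
Lemma psi_gap b q : (2 <= q)%N ->
  -0.4724 <= psi ^ (2 * b + 2) * (psi ^ q - 1) < 0.
Proof.
move=> /psi_ge2 Hq; have E : ~~ odd (2 * b + 2) by lia.
have := psi_even E; have := @psi_ge2 (2 * b + 2) ltac:(lia).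
by set x := psi ^ (_ + _) => H1 H2; nra.
Qed.

Lemma no_cube_ends c b q j : (2 <= c)%N -> (2 <= q)%N ->
  (j.+2 + fib (c + (2 * b + 2)) = fib (c + (2 * b + 2) + q) + fib c)%N ->
  cubes_f j = false.
Proof.
set R := (c + (2 * b + 2))%N => c2 q2 Ej; apply: cubes_f_false => K K2 HK.
(* The cube must fit: 3 F_K <= j + 1 < F_(R+q) <= 3 F_(R+q-2). *)
have KQ : (K + 3 <= R + q)%N.
  case: (leqP (K + 3) (R + q)) => // HQ.
  have L1 := @leq_fib (R + q - 2) K ltac:(lia).
  have [x Ex] : exists x, (R + q = x.+3)%N by exists (R + q - 3)%N; lia.
  have L2 := @leq_fib c R ltac:(lia).
  have L3 := fib_gt0 K.-1.
  rewrite Ex (_ : x.+3 - 2 = x.+1)%N in L1; last by lia.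
  have F1 := fibSS x.+1; have F2 := fibSS x; have L4 := leq_fib (leqnSn x).
  by rewrite Ex in Ej; lia.
have cR : (fib c <= fib R)%N by apply: leq_fib; lia.
have pb := psi_bounds; have p2 := psi2; have q_le := psi_ge2 q2.
have K1 : (fib K.+1 <= 2 * fib K)%N.
  have [x Ex] : exists x, K = x.+1 by exists K.-1; lia.
  by rewrite Ex fibSS; have := leq_fib (leqnSn x); lia.
have CQR := cong_sub (cong_fib (R + q)) (cong_fib R).
have CK := cong_fib K.+1.
case: (leqP K c) => [Kc|cK].
  have [g Eg] : exists g, c = (K + g)%N by exists (c - K)%N; lia.
  have C : cong (Z.of_nat j.+2)
             (psi ^ K * (psi ^ g * (1 + psi ^ (2 * b + 2) * (psi ^ q - 1)))).
    have := cong_add CQR (cong_fib c); congr (cong _ _); first by lia.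
    by rewrite /R Eg !pow_add; ring.
  have U := psi_gap b q2; set u := psi ^ (_ + _) * _ in C U.
  (* For even g, [j.+2] itself is an obstruction. For odd g its coordinate lies in (psi, 0), and
     subtracting F_(K+1) adds - psi. *)
  case: (boolP (odd g)) => [/psi_odd|/psi_even] G; last first.
    by exists (Z.of_nat j.+2), (psi ^ g * (1 + u)); split; [nra| |lia].
  exists (Z.of_nat j.+2 - Z.of_nat (fib K.+1))%Z, (psi ^ g * (1 + u) - psi).
  split; [nra| |lia].
  by have := cong_sub C CK; congr (cong _ _); rewrite /=; ring.
case: (leqP R K) => [RK|KR].
  (* Dropping F_c - F_R leaves psi^(R+q), so small against psi^K that adding - psi puts the
     coordinate in (0, 1). *)
  exists (Z.of_nat (fib (R + q)) - Z.of_nat (fib K.+1))%Z, (psi ^ (R + q - K) - psi).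
  have S := @leq_fib R K.+1 ltac:(lia).
  split; last by lia.
    have [x Ex] : exists x, (R + q - K = x.+3)%N by exists (R + q - K - 3)%N; lia.
    by have := @psi_ge2 x.+2 ltac:(lia); rewrite Ex /=; nra.
  have := cong_sub (cong_fib (R + q)) CK; congr (cong _ _).
  by rewrite -{1}(subnK (_ : (K <= R + q)%N)) ?pow_add /=; [ring|lia].
have [r Er] : exists r, R = (K + r.+1)%N by exists (R - K - 1)%N; lia.
have cK1 := leq_fib (ltnW cK).
have E : psi ^ (R + q) - psi ^ R = psi ^ K * (psi ^ r.+1 * (psi ^ q - 1)).
  by rewrite Er !pow_add; ring.
rewrite {}E in CQR.
case: (boolP (odd r.+1)) => [/psi_odd|] G.
  exists (Z.of_nat (fib (R + q)) - Z.of_nat (fib R))%Z, (psi ^ r.+1 * (psi ^ q - 1)).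
  by split; [nra| |lia].
have L := @psi_ge2 r.+1 ltac:(lia); have L' := psi_even G.
exists (Z.of_nat (fib (R + q)) - Z.of_nat (fib R) - Z.of_nat (fib K.+1))%Z.
exists (psi ^ r.+1 * (psi ^ q - 1) - psi); split; [nra| |].
  by have := cong_sub CQR CK; congr (cong _ _); rewrite /=; ring.
(* K - c is even here, so c <= K - 2 and F_c + F_(K+1) <= 2 F_K. *)
have [x Ex] : exists x, K = x.+2 by exists (K - 2)%N; lia.
have := @leq_fib c x ltac:(lia).
by move: K1; rewrite Ex (fibSS x.+1) (fibSS x); lia.
Qed.

(** * Positions at which a cube of Fibonacci order ends *)

(** By [rot_bound], every other s in this range moves by at least |psi|^k; beyond F_(k+1), split it
    off first. *)
Lemma cong_near k s v : (2 <= k)%N -> (0 < s < fib k.+2)%N ->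
  cong (Z.of_nat s) (psi ^ k * v) -> -1 < v < 1 -> s = fib k.+1.
Proof.
case: k => [|[|k]] // _; case: s => // n Hs /(cong_uniq (cong_rot n)) [z Ez] Hv.
have G := delta_gt0 k.+2.
have far : (- psi) ^ k.+2 <= rot n <= 1 - (- psi) ^ k.+2 -> False.
  move=> B; suff : 0 < IZR z < 1 by move=> [/lt_IZR H1 /lt_IZR H2]; lia.
  by case: (psi_delta k.+2) => E; rewrite E in Ez; nra.
case: (ltngtP n.+1 (fib k.+3)) => // H; first by case: far; apply: rot_bound.
have [r Er] : exists r, n = (fib k.+3 + r)%N by exists (n - fib k.+3)%N; lia.
have Hr : (r.+1 < fib k.+2)%N by move: Hs; rewrite Er (fibSS k.+2); lia.
case: far; rewrite Er rot_fib_add; last by lia.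
have := rot_bound Hr; have := deltaSS k.+1; have := delta_gt0 k.+3.
by case: (psi_delta k.+3) => ->; lra.
Qed.

Lemma Rdiv_lt01 x d : 0 < x < d -> 0 < x / d < 1.
Proof.
move=> Hx; have d0 : 0 < d by lra.
have Hd := Rinv_0_lt_compat d d0; split; first by apply: Rmult_lt_0_compat; lra.
have <- : d / d = 1 by field; lra.
by apply: Rmult_lt_compat_r; lra.
Qed.

(** The cube has order F_(k+2). It could fail only if a jump of F_(k+2) steps crossed 0, which would
    be too early a return to psi^(k+2) (0,1). *)
Lemma cube_ends_run k b q j : (2 <= k)%N -> (2 <= q)%N ->
  let P := (fib (k.+2 + (2 * b + 2) + q) + fib k - fib (k.+2 + (2 * b + 2)))%N in
  (P <= j.+1 < P + fib k.+1 - 1)%N -> cubes_f j = true.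
Proof.
move=> k2 q2; set R := (k.+2 + (2 * b + 2))%N => P Hj.
have LR : (fib R + fib k.+4.+1 <= fib (R + q))%N.
  have := @leq_fib R.+2 (R + q) ltac:(lia); have := @leq_fib k.+4.+1 R.+1 ltac:(lia).
  by rewrite (fibSS R); lia.
have F5 := fibSS k.+3; have F4 := fibSS k.+2; have F3 := fibSS k.+1; have F2 := fibSS k.
have [a Ea] : exists a, (j.+1 = a + 3 * fib k.+2)%N.
  by exists (j.+1 - 3 * fib k.+2)%N; rewrite /P in Hj; lia.
apply/boolp.asboolP/cube_ends_atP; exists a, (fib k.+2).
split=> //; first exact: fib_gt0.
apply/has_cube_rot.
suff E n : (a <= n <= a + 2 * fib k.+2)%N ->
    rot (n + fib k.+2) - rot n = psi ^ k.+2.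
  by move=> n Hn; rewrite !E //; lia.
move=> Hn; have C1 : cong (Z.of_nat (n + fib k.+2).+1) (rot n + psi ^ k.+2).
  by have := cong_add (cong_rot n) (cong_fib k.+2); congr (cong _ _); lia.
have [z Ez] := cong_uniq (cong_rot (n + fib k.+2)) C1.
have R0 := rot01 n; have R1 := rot01 (n + fib k.+2).
have pk := @psi_ge2 k.+2 ltac:(lia).
have [z0|z0] := Z.eq_dec z 0; first by rewrite Ez z0; lra.
have [y [Hy Cy]] : exists y,
    0 < y < 1 /\ cong (Z.of_nat (n + fib k.+2).+1) (psi ^ k.+2 * y).
  have z1 : z = 1%Z \/ z = (-1)%Z.
    have [H1 H2] : -2 < IZR z < 2 by lra.
    by move: H1 H2 => /lt_IZR H1 /lt_IZR H2; lia.
  have D := delta_gt0 k.+2.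
  have pnz : psi ^ k.+2 <> 0 by case: (psi_delta k.+2) => ->; lra.
  case: z1 => z1; rewrite z1 in Ez.
    exists ((1 - rot (n + fib k.+2)) / - psi ^ k.+2).
    split; first by apply: Rdiv_lt01; lra.
    by have := cong_addZ (-1) (cong_rot (n + fib k.+2)); congr (cong _ _); field.
  exists (rot (n + fib k.+2) / psi ^ k.+2).
  split; first by apply: Rdiv_lt01; lra.
  by have := cong_rot (n + fib k.+2); congr (cong _ _); field.
have U := psi_gap b q2; set h := psi ^ (_ + _) * _ in U.
have CP : cong (Z.of_nat P) (psi ^ k.+2 * (2 - psi + h)).
  have := cong_add (cong_sub (cong_fib (R + q)) (cong_fib R)) (cong_fib k).
  congr (cong _ _); first by rewrite /P; lia.
  (* That is, psi^(-2) = 2 - psi. *)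
  have E : psi ^ k = psi ^ k.+2 * (2 - psi).
    have -> : psi ^ k.+2 * (2 - psi) = (2 * (psi * psi) - psi * (psi * psi)) * psi ^ k.
      by rewrite /=; ring.
    have -> : psi * (psi * psi) = 2 * psi + 1 by rewrite psi2; have := psi2; lra.
    by rewrite psi2; ring.
  by rewrite E /h /R !pow_add; ring.
(* [s] counts the steps from P - 2 F_(k+2), of coordinate h - psi, to the crossing. The bounds on j
   give 0 < s < 2 F_(k+2) + F_(k+1) = F_(k+4). *)
have [s Es] : exists s, (s + P = (n + fib k.+2).+1 + 2 * fib k.+2)%N.
  by exists ((n + fib k.+2).+1 + 2 * fib k.+2 - P)%N; lia.
have Cs : cong (Z.of_nat s) (psi ^ k.+2 * (y + psi - h)).
  have := cong_add (cong_sub Cy CP) (cong_add (cong_fib k.+2) (cong_fib k.+2)).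
  by congr (cong _ _); [lia|ring].
have pb := psi_bounds.
have Es1 : s = fib k.+3 by apply: cong_near Cs _ => //; [lia|lra].
(* A return after F_(k+3) steps would force y = h, but h < 0 < y. *)
have [z' Ez'] := cong_uniq Cs (eq_ind_r (fun m => cong (Z.of_nat m) _) (cong_fib k.+3) Es1).
have Ez'' : IZR z' = psi ^ k.+2 * (y - h).
  by move: Ez'; rewrite -[psi ^ k.+3]/(psi * psi ^ k.+2); lra.
have z'0 : IZR z' = 0 by apply: IZR_small; rewrite Ez''; nra.
move: Ez''; rewrite z'0 => /esym /Rmult_integral [] E0; last by lra.
by case: (psi_delta k.+2); have := delta_gt0 k.+2; lra.
Qed.

(** Just after the run c = k + 2, as F_k + F_(k+1) = F_(k+2); just before it c = k, with b + 1
    keeping R unchanged. *)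
Lemma run_of_ones_cubes_f k b q i : (2 <= k)%N -> (2 <= q)%N ->
  (i.+1 + fib (k.+2 + (2 * b + 2)) = fib (k.+2 + (2 * b + 2) + q) + fib k)%N ->
  run_of_ones cubes_f i (fib k.+1 - 1).
Proof.
move=> k2 q2 Ei.
have L : (2 <= fib k.+1)%N by apply: (@leq_fib 3 k.+1).
split; first by lia.
- move=> n Hn; apply: (@cube_ends_run k b q) => //; lia.
- apply: (@no_cube_ends k.+2 b q) => //; have := fibSS k; lia.
case: i Ei => [|i] Ei; [by left|right].
rewrite subn1 /=; apply: (@no_cube_ends k b.+1 q) => //.
by move: Ei; rewrite !addSn (_ : (k + (2 * b.+1 + 2) = (k + (2 * b + 2)).+2)%N) //; lia.
Qed.

Close Scope R_scope.

(** * Values of the words in the regular expressions *)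

(** [fib_value] is the case s = 2; a variable lowest weight F_s evaluates a factor inside a longer
    word. *)
Definition shifted_value (s : nat) (d : seq bool) : nat :=
  \sum_(k < size d) nth false (rev d) k * fib (k + s).

Lemma shifted_value_cat s d e :
  shifted_value s (d ++ e) = shifted_value (size e + s) d + shifted_value s e.
Proof.
rewrite /shifted_value size_cat addnC big_split_ord /= addnC; congr (_ + _).
  apply: eq_bigr => k _; rewrite rev_cat nth_cat size_rev ltnNge leq_addr /=.
  by rewrite addKn addnCA addnA.
by apply: eq_bigr => k _; rewrite rev_cat nth_cat size_rev ltn_ord.
Qed.

Lemma shifted_value_cons s x d :
  shifted_value s (x :: d) = x * fib (size d + s) + shifted_value s d.
Proof.
rewrite -cat1s shifted_value_cat; congr (_ + _).
by rewrite /shifted_value big_ord1.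
Qed.

Lemma shifted_value_nil s : shifted_value s [::] = 0.
Proof. by rewrite /shifted_value big_ord0. Qed.

Lemma shifted_value10 s : shifted_value s [:: true; false] = fib s.+1.
Proof. by rewrite 2!shifted_value_cons shifted_value_nil mul1n mul0n !addn0. Qed.

(** The sum F_(s+1) + F_(s+3) + ... telescopes. *)
Lemma lstar_w10_value w : lstar w10 w -> exists c, size w = 2 * c /\
  forall s, shifted_value s w + fib s = fib (2 * c + s).
Proof.
elim=> [|_ v -> _ [c [sv IH]]].
  by exists 0; split=> // s; rewrite shifted_value_nil.
exists c.+1; split=> [|s]; first by rewrite /= sv; lia.
rewrite shifted_value_cat shifted_value10 sv -addnA IH.
by rewrite (_ : 2 * c.+1 + s = (2 * c + s).+2) //; lia.
Qed.

Lemma lstar_w00_value w : lstar w00 w -> exists b, size w = 2 * b /\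
  forall s, shifted_value s w = 0.
Proof.
elim=> [|_ v -> _ [c [sv IH]]].
  by exists 0; split=> // s; rewrite shifted_value_nil.
exists c.+1; split=> [|s]; first by rewrite /= sv; lia.
by rewrite shifted_value_cat 2!shifted_value_cons shifted_value_nil IH.
Qed.

(** After its leading 0, w is the largest Zeckendorf word of its length. *)
Lemma run_start_suffix_value w : run_start_suffix w ->
  0 < size w /\ (shifted_value 2 w).+1 = fib (size w).+1.
Proof.
move=> [_ [_ [-> [u [v [/lstar_w10_value [c [su Hu]] Hv ->]]] ->]]].
split=> //; rewrite shifted_value_cat shifted_value_cons shifted_value_nil.
rewrite mul0n !add0n shifted_value_cat !size_cat su.
case: Hv => ->; rewrite ?shifted_value_cons shifted_value_nil.
  have := Hu 2.
  rewrite (_ : (size [:: false] + (2 * c + size [::])).+1 = 2 * c + 2); last by rewrite /=; lia.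
  by rewrite !add0n addn0 addn1.
have := Hu 3.
rewrite (_ : (size [:: false] + (2 * c + size [:: true])).+1 = 2 * c + 3); last by rewrite /=; lia.
by move=> <-; rewrite mul1n addn0 -addnS.
Qed.

(** Put R = s + 2b + 3. The block (10)^a gives F_(R+2a) - F_R if the middle is 0; if it is 10, the
    sum is F_(R+1+2a) - F_(R+1) + F_(R-1), where F_(R+1) - F_(R-1) = F_R. *)
Lemma run_start_prefix_value p s : run_start_prefix p ->
  exists b q, 2 <= q /\
    shifted_value s p + fib (s.+1 + (2 * b + 2)) = fib (s.+1 + (2 * b + 2) + q).
Proof.
move=> [_ [_ [[_ [w [-> Hw ->]]]
  [_ [_ [-> [u [_ [Hu [v [_ [/lstar_w00_value [b [sv Hv]] -> ->]]] ->]]] ->]]] ->]]].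
have [a [sw Va]] := lstar_w10_value (lstar_cat (erefl : w10 [:: true; false]) Hw).
have a0 : 0 < a by move: sw; rewrite size_cat /=; lia.
move: (_ ++ w) sw Va => d _ Va.
have V0 t : shifted_value t [:: false] = 0.
  by rewrite shifted_value_cons shifted_value_nil.
rewrite !shifted_value_cat !V0 Hv !size_cat sv; exists b.
case: Hu => ->.
  exists (2 * a); split; first by lia.
  rewrite V0 !addn0.
  rewrite (_ : s.+1 + (2 * b + 2) + _ = 2 * a + (s.+1 + (2 * b + 2))); last by lia.
  by rewrite -Va; congr (shifted_value _ _ + _); rewrite /=; lia.
exists (2 * a).+1; split; first by lia.
rewrite shifted_value10 !addn0 !add0n.
rewrite (_ : s.+1 + (2 * b + 2) + _ = 2 * a + (s.+1 + (2 * b + 2)).+1); last by lia.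
rewrite -Va -addnA; congr (shifted_value _ _ + _); first by rewrite /=; lia.
rewrite (_ : s.+1 + (2 * b + 2) = (s + 2 * b).+3); last by lia.
have -> : 2 * b + size [:: false] + s = (s + 2 * b).+1 by rewrite /=; lia.
by rewrite !fibSS; lia.
Qed.

(** * From representations to runs *)

Lemma run_start_run i r w : is_fib_rep i r -> run_start_suffix w ->
  lcat run_start_prefix (lword w) r ->
  run_of_ones cubes_f i (fib (size w).+2 - 1).
Proof.
move=> [_ _ <-] /run_start_suffix_value [w0 Ew] [p [_ [Hp -> ->]]].
have [b [q [q2 Ep]]] := run_start_prefix_value (size w + 2) Hp.
apply: (@run_of_ones_cubes_f (size w).+1 b q) => //.
rewrite (_ : fib_value _ = shifted_value 2 (p ++ w)) //.
rewrite shifted_value_cat -addnS Ew; move: Ep; rewrite addn2; lia.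
Qed.

Theorem theorem1 :
  (forall L : nat, exists i l : nat, L <= l /\ run_of_ones cubes_f i l)
  /\
  (forall (i : nat) (r w : seq bool),
     is_fib_rep i r ->
     run_start_suffix w ->
     lcat run_start_prefix (lword w) r ->
     (forall n : nat, size w = 2 * n ->
        run_of_ones cubes_f i (fib (2 * n + 2) - 1)) /\
     (forall n : nat, size w = 2 * n + 1 ->
        run_of_ones cubes_f i (fib (2 * n + 3) - 1))).
Proof.
split=> [L|i r w Hi Hw Hr]; last first.
  have H := run_start_run Hi Hw Hr.
  split=> n En; first by rewrite -En addn2.
  by rewrite (_ : 2 * n + 3 = (size w).+2) //; lia.
have L_fib : L < fib L.+2.
  by elim: L => // L IH; rewrite fibSS; have := fib_gt0 L; lia.
(* The case k = L + 2, b = 0, q = 2 gives a starting position directly, with no digit word. *)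
set R := L.+4 + (2 * 0 + 2); have RR := leq_fib (leq_addr 2 R).
exists (fib (R + 2) + fib L.+2 - fib R - 1), (fib L.+3 - 1); split.
  by have := leq_fib (leqnSn L.+2); lia.
apply: (@run_of_ones_cubes_f L.+2 0 2) => //.
by rewrite -/R; lia.
Qed.
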